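(* Let $(G,o)$ be a Menger algebra of rank $n$ and let $H\subseteq G$ be a strong subset. Then $\mathcal{R}_H$ is a $v$-cancellative $v$-congruence if and only if $W_H$ is $l$-consistent in $(G,o)$.
   Context: Let $n$ be a positive integer. A Menger algebra $(G,o)$ of rank $n$ is a nonempty set $G$ with an $(n+1)$-ary operation $o:(f,g_1,\ldots,g_n)\mapsto f[g_1\ldots g_n]$ satisfying the superassociative law $f[g_1\ldots g_n][h_1\ldots h_n]=f[g_1[h_1\ldots h_n]\ldots g_n[h_1\ldots h_n]]$ for all $f,g_i,h_i\in G$. For $u,x\in G$, $\overline{w}=(w_1,\ldots,w_n)\in G^n$ and $1\le i\le n$, $u[\overline{w}|_i x]$ denotes $u[w_1\ldots w_{i-1}\,x\,w_{i+1}\ldots w_n]$. $T_n(G)$ is the smallest set of polynomials in one variable $x$ such that $x\in T_n(G)$ and, whenever $i\in\{1,\ldots,n\}$, $a,b_1,\ldots,b_{i-1},b_{i+1},\ldots,b_n\in G$ and $t\in T_n(G)$, also $a[b_1\ldots b_{i-1}\,t\,b_{i+1}\ldots b_n]\in T_n(G)$. Each $t\in T_n(G)$ is identified with the map $G\to G$, $x\mapsto t(x)$, it defines. For $H\subseteq G$ and $a\in G$ put $\rho_H\langle a\rangle=\{t\in T_n(G)\mid t(a)\in H\}$, $\mathcal{R}_H=\{(a,b)\in G\times G\mid \rho_H\langle a\rangle=\rho_H\langle b\rangle\}$ and $W_H=\{a\in G\mid\rho_H\langle a\rangle=\varnothing\}$. The subset $H$ is strong if for all $a,b\in G$, $\rho_H\langle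 a\rangle\cap\rho_H\langle b\rangle\neq\varnothing$ implies $\rho_H\langle a\rangle=\rho_H\langle b\rangle$. A relation $\rho\subseteq G\times G$ is $v$-regular if $(x_1,y_1),\ldots,(x_n,y_n)\in\rho$ implies $(z[x_1\ldots x_n],z[y_1\ldots y_n])\in\rho$ for all $x_i,y_i,z\in G$; a $v$-congruence is a $v$-regular equivalence relation. The relation $\rho$ is $v$-cancellative if for all $x,y,u\in G$, $\overline{w}\in G^n$, $i=1,\ldots,n$, $(u[\overline{w}|_i x],u[\overline{w}|_i y])\in\rho$ implies $(x,y)\in\rho$. A (possibly empty) subset $X\subseteq G$ is $l$-consistent in $(G,o)$ if for all $g\in G$ and $t\in T_n(G)$, $t(g)\in X$ implies $g\in X$. *)

(* Defs.v *)
From HB Require Import structures.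
From mathcomp Require Import all_boot.
From mathcomp Require Import boolp classical_sets.
From Corelib Require Import Relation_Definitions RelationClasses.

Set Implicit Arguments.
Unset Strict Implicit.
Unset Printing Implicit Defensive.

Local Open Scope classical_set_scope.

(* [mop f g] is f[g_1 ... g_n]; the rank n may be 0 here, positivity is a
   hypothesis of the theorems. *)
HB.mixin Record isMengerAlgebra (n : nat) (G : Type) := {
  mop : G -> {ffun 'I_n -> G} -> G;
  mopA : forall (f : G) (g h : {ffun 'I_n -> G}),
    mop (mop f g) h = mop f [ffun i => mop (g i) h];
  menger_inhabited : inhabited G
}.

#[short(type="mengerAlgType")]
HB.structure Definition MengerAlgebra (n : nat) :=
  {G of isMengerAlgebra n G}.

Section Menger.
Context {n : nat} {G : mengerAlgType n}.
Implicit Types (H X : set G) (w : {ffun 'I_n -> G}) (rho : relation G).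

(* The tuple w with its i-th entry replaced by x, so that
   mop u (subst_at w i x) is u[w|_i x]. *)
Definition subst_at w (i : 'I_n) (x : G) : {ffun 'I_n -> G} :=
  [ffun j => if j == i then x else w j].

(* T_n(G), its polynomials being identified with the maps they define; the
   i-th entry of b is irrelevant. *)
Inductive polyT : set (G -> G) :=
| polyT_id : polyT (fun x => x)
| polyT_step (i : 'I_n) (a : G) (b : {ffun 'I_n -> G}) (t : G -> G) :
    polyT t -> polyT (fun x => mop a (subst_at b i (t x))).

Definition rhoH H (a : G) : set (G -> G) := [set t | polyT t /\ H (t a)].

Definition relH H : relation G := fun a b => rhoH H a = rhoH H b.

Definition WH H : set G := [set a | rhoH H a = set0].

Definition strong H : Prop :=
  forall a b : G, rhoH H a `&` rhoH H b !=set0 -> rhoH H a = rhoH H b.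

Definition v_regular rho : Prop :=
  forall (x y : {ffun 'I_n -> G}) (z : G),
    (forall i, rho (x i) (y i)) -> rho (mop z x) (mop z y).

Definition v_congruence rho : Prop := Equivalence rho /\ v_regular rho.

Definition v_cancellative rho : Prop :=
  forall (x y u : G) (w : {ffun 'I_n -> G}) (i : 'I_n),
    rho (mop u (subst_at w i x)) (mop u (subst_at w i y)) -> rho x y.

Definition l_consistent X : Prop :=
  forall (g : G) (t : G -> G), polyT t -> X (t g) -> X g.

End Menger.

(* Main.v *)
(** For any [H], translations preserve [relH H] and [WH H], so [relH H] is always
a v-congruence. If [relH H] is v-cancellative and [a = u[w|_i g]] is in [WH H], then
[u[w|_i a]] is in [WH H] too; hence [u[w|_i g]] and [u[w|_i a]] are related, and
cancellation relates [g] to [a]. Conversely, if [u[w|_i x]] and [u[w|_i y]] are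
related, then either some [t] sends both into [H] and strongness applies to
[x] and [y], or both lie in [WH H], and so do [x] and [y] by l-consistency. *)

Require Import Defs.
From mathcomp Require Import all_boot.
From mathcomp Require Import classical_sets.
From Corelib Require Import RelationClasses.

Set Implicit Arguments.
Unset Strict Implicit.
Unset Printing Implicit Defensive.

Lemma subst_at_id (n : nat) (G : mengerAlgType n) (w : {ffun 'I_n -> G}) i :
  subst_at w i (w i) = w.
Proof. by apply/ffunP => j; rewrite ffunE; case: eqP => [->|]. Qed.

Lemma polyT_comp (n : nat) (G : mengerAlgType n) (s t : G -> G) :
  polyT s -> polyT t -> polyT (s \o t).
Proof.
by move=> Ts Tt; elim: Ts => [//|i a b s' _ IH]; apply: (polyT_step i a b IH).
Qed.

Lemma polyT_subst_at (n : nat) (G : mengerAlgType n) (u : G)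
  (w : {ffun 'I_n -> G}) i : polyT (fun x => mop u (subst_at w i x)).
Proof. exact: (polyT_step i u w (polyT_id (G := G))). Qed.

Lemma rhoH_polyT (n : nat) (G : mengerAlgType n) (H : set G) (s t : G -> G) a :
  polyT t -> rhoH H (t a) s -> rhoH H a (s \o t).
Proof. by move=> Tt [Ts Hs]; split => //; apply: polyT_comp. Qed.

(** If [s] sends [t a] into [H], then [s \o t] sends [a], hence also [b], into [H]. *)
Lemma relH_polyT (n : nat) (G : mengerAlgType n) (H : set G) (t : G -> G) a b :
  polyT t -> relH H a b -> relH H (t a) (t b).
Proof.
move=> Tt; rewrite /relH => ab; apply/seteqP; split=> s sH.
  by have := rhoH_polyT Tt sH; rewrite ab => -[_ ?]; split => //; case: sH.
by have := rhoH_polyT Tt sH; rewrite -ab => -[_ ?]; split => //; case: sH.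
Qed.

Lemma WH_polyT (n : nat) (G : mengerAlgType n) (H : set G) (t : G -> G) a :
  polyT t -> WH H a -> WH H (t a).
Proof.
move=> Tt Wa; rewrite /WH /= -subset0 => s /(rhoH_polyT Tt).
by rewrite Wa.
Qed.

Lemma relH_equivalence (n : nat) (G : mengerAlgType n) (H : set G) :
  Equivalence (relH H).
Proof. by split=> [a //|a b ab|a b c ab bc]; rewrite /relH ?ab. Qed.

Lemma relH_v_regular (n : nat) (G : mengerAlgType n) (H : set G) :
  v_regular (relH H).
Proof.
move=> x y z xy.
(* [x] is turned into [y] one coordinate at a time. *)
pose h k : {ffun 'I_n -> G} := [ffun j : 'I_n => if (j < k)%N then y j else x j].
have h0 : h 0%N = x by apply/ffunP => j; rewrite ffunE.
have hn : h n = y by apply/ffunP => j; rewrite ffunE ltn_ord.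
suff hk k : (k <= n)%N -> relH H (mop z (h 0%N)) (mop z (h k)).
  by have := hk n (leqnn n); rewrite h0 hn.
elim: k => [//|k IH lt_kn].
pose i := Ordinal lt_kn.
have hS : h k.+1 = subst_at (h k) i (y i).
  apply/ffunP => j; rewrite !ffunE ltnS leq_eqVlt -val_eqE /=.
  by case: eqP => //= jk; congr (y _); apply: val_inj.
have hx : h k i = x i by rewrite ffunE ltnn.
(* [h k] is itself a substitution at [i], with [x i] inserted, so both sides come from one
   translation, taken at [x i] and at [y i]. *)
rewrite /relH (IH (ltnW lt_kn)) hS -{1}(subst_at_id (h k) i) hx.
exact: (relH_polyT (polyT_subst_at z (h k) i) (xy i)).
Qed.

Lemma v_cancellative_l_consistent (n : nat) (G : mengerAlgType n) (H : set G) :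
  v_cancellative (relH H) -> l_consistent (WH H).
Proof.
(* Induction strips the outermost operation of [t], so it is [s g] that gets related to its
   translate. *)
move=> can g t Tt; elim: Tt => [//|i u w s _ IH] Wa; apply: IH.
have Wa' := WH_polyT (polyT_subst_at u w i) Wa.
(* Any two elements of [WH H] are related, both having empty [rhoH]. *)
have ga := can _ _ _ _ _ (etrans Wa (esym Wa')).
by rewrite /WH /= ga.
Qed.

Lemma l_consistent_v_cancellative (n : nat) (G : mengerAlgType n) (H : set G) :
  strong H -> l_consistent (WH H) -> v_cancellative (relH H).
Proof.
move=> H_strong Wl x y u w i xy; have Tt := polyT_subst_at u w i.
have [Wx|/set0P[t tx]] := eqVneq (rhoH H (mop u (subst_at w i x))) set0.
  have Wy : WH H (mop u (subst_at w i y)) by rewrite /WH /= -xy.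
  exact: etrans (Wl _ _ Tt Wx) (esym (Wl _ _ Tt Wy)).
(* By [xy], [t] sends both translates into [H], so the composite sends [x] and [y] there. *)
apply: H_strong; exists (t \o (fun v => mop u (subst_at w i v))).
by split; apply: (rhoH_polyT Tt); rewrite // -xy.
Qed.

Theorem proposition2p16 (n : nat) (n_gt0 : (0 < n)%N) (G : mengerAlgType n)
  (H : set G) (H_strong : strong H) :
  v_cancellative (relH H) /\ v_congruence (relH H) <-> l_consistent (WH H).
Proof.
split=> [[can _]|Wl]; first exact: v_cancellative_l_consistent.
split; first exact: l_consistent_v_cancellative.
by split; [exact: relH_equivalence|exact: relH_v_regular].
Qed.
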